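(* Let $P,Q,t_0,t_1\in\mathbb{R}$ with $Q\ne0$, and let $(T_n)_{n\in\mathbb{Z}}$ be the second-order linear sequence with $T_{n+2}=PT_{n+1}-QT_n$ for all $n\in\mathbb{Z}$ and $(T_0,T_1)=(t_0,t_1)$. Let $B=B(x)$ be a solution of the Riccati equation $$B'=\frac{P}{Q}B(B-P)+P$$ with the initial condition $B(0)=0$. Then $$\tau_n(x)=\left(T_n-T_{n-1}B(x)\right)e^{nx}\qquad(n\in\mathbb{Z})$$ is a solution, on the interval of definition of $B$, of the differential-difference equation $$\tau_n\frac{\partial\tau_{n+1}}{\partial x}-\tau_{n+1}\frac{\partial\tau_n}{\partial x}=\tau_{n-1}\tau_{n+2}\qquad(n\in\mathbb{Z})$$ with the condition $\tau_n(0)=T_n$. *)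

(* Defs.v *)
(* MathComp-Analysis; the reals are an arbitrary [R : realType]. *)
From mathcomp Require Import all_boot all_order all_algebra.
From mathcomp Require Import all_classical all_reals all_analysis.

Set Implicit Arguments.
Unset Strict Implicit.
Unset Printing Implicit Defensive.

Import Order.TTheory GRing.Theory Num.Theory.
Import numFieldNormedType.Exports.

Local Open Scope classical_set_scope.
Local Open Scope ring_scope.

Definition second_order_linear_seq (R : realType) (P Q t0 t1 : R)
    (T : int -> R) : Prop :=
  (forall n : int, T (n + 2) = P * T (n + 1) - Q * T n) /\ T 0 = t0 /\ T 1 = t1.

(* The values of [B] outside [I] are irrelevant: [I] is meant to be open, so
   derivability at a point of [I] only involves values of [B] on [I]. *)
Definition riccati_solution (R : realType) (P Q : R) (I : set R)
    (B : R -> R) : Prop :=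
  forall x : R, I x ->
    derivable B x 1 /\ derive1 B x = P / Q * B x * (B x - P) + P.

Definition tau_of (R : realType) (T : int -> R) (B : R -> R)
    (n : int) (x : R) : R :=
  (T n - T (n - 1) * B x) * expR (n%:~R * x).

Definition diff_difference_solution (R : realType) (I : set R)
    (tau : int -> R -> R) : Prop :=
  forall (n : int) (x : R), I x ->
    derivable (tau n) x 1 /\
    tau n x * derive1 (tau (n + 1)) x - tau (n + 1) x * derive1 (tau n) x
      = tau (n - 1) x * tau (n + 2) x.

(* Main.v *)
Require Import Defs.
From mathcomp Require Import all_boot all_order all_algebra.
From mathcomp Require Import all_classical all_reals all_analysis.
From mathcomp Require Import ring.

Set Implicit Arguments.
Unset Strict Implicit.
Unset Printing Implicit Defensive.

Import Order.TTheory GRing.Theory Num.Theory.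
Import numFieldNormedType.Exports.

Local Open Scope classical_set_scope.
Local Open Scope ring_scope.

(** In [tau_n tau_(n+1)' - tau_(n+1) tau_n'] and in [tau_(n-1) tau_(n+2)] the
    exponentials contribute the same factor [exp((2n+1)x)].  Once the Riccati
    equation eliminates [B'] and the recurrence writes [T_(n-2)], [T_(n+1)] and
    [T_(n+2)] in terms of [T_(n-1)] and [T_n], what remains is an identity
    between polynomials of degree two in [B]. *)

(** Product rule, with the exponential factored out and [derive1 B x] left symbolic for the Riccati
    equation to replace. *)
Lemma is_derive_tau_of (R : realType) (T : int -> R) (B : R -> R) (n : int)
    (x : R) :
  derivable B x 1 ->
  is_derive x 1 (tau_of T B n)
    ((n%:~R * (T n - T (n - 1) * B x) - T (n - 1) * derive1 B x)
     * expR (n%:~R * x)).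
Proof.
move=> dB; have BdB : is_derive x 1 B (derive1 B x).
  by rewrite derive1E; apply: derivableP.
rewrite /tau_of; apply: is_derive_eq.
rewrite /GRing.scale /=; ring.
Qed.

Theorem theorem7p2 (R : realType) (P Q t0 t1 : R) (T : int -> R)
    (I : set R) (B : R -> R)
    (hQ : Q != 0)
    (hT : second_order_linear_seq P Q t0 t1 T)
    (hIopen : open I) (hIint : is_interval I) (hI0 : I 0)
    (hB : riccati_solution P Q I B) (hB0 : B 0 = 0) :
  diff_difference_solution I (tau_of T B) /\
  (forall n : int, tau_of T B n 0 = T n).
Proof.
case: hT => recT _; split=> [n x Ix|n]; last first.
  by rewrite /tau_of hB0 !mulr0 subr0 expR0 mulr1.
have [dB B'E] := hB x Ix.
have dtau m := is_derive_tau_of T m dB.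
split; first exact: (@ex_derive _ _ _ _ _ _ _ (dtau n)).
have tau'E m := etrans (derive1E _ _) (@derive_val _ _ _ _ _ _ _ (dtau m)).
rewrite !tau'E /tau_of B'E.
have -> : n + 1 - 1 = n by ring.
have -> : n + 2 - 1 = n + 1 by ring.
have -> : n - 1 - 1 = n - 2 by ring.
have recT1 : T (n + 2) = P * T (n + 1) - Q * T n := recT n.
have recT0 : T (n + 1) = P * T n - Q * T (n - 1).
  have := recT (n - 1).
  have -> : n - 1 + 2 = n + 1 by ring.
  by have -> : n - 1 + 1 = n by ring.
(* Running the recurrence backwards divides by [Q], hence needs [hQ]. *)
have recTN : T (n - 2) = (P * T (n - 1) - T n) / Q.
  have := recT (n - 2).
  have -> : n - 2 + 2 = n by ring.
  have -> : n - 2 + 1 = n - 1 by ring.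
  by move=> ->; field.
have expE : expR ((n - 1)%:~R * x) * expR ((n + 2)%:~R * x)
    = expR (n%:~R * x) * expR ((n + 1)%:~R * x).
  by rewrite -!expRD; congr expR; rewrite !intrD; ring.
rewrite [RHS]mulrACA expE.
(* Naming the exponentials shields their exponents from [intrD], which must split only the
   coefficient [(n + 1)%:~R]; [recT1] precedes [recT0] because it brings in [T (n + 1)]. *)
set e0 := expR (n%:~R * x); set e1 := expR ((n + 1)%:~R * x).
by rewrite intrD recT1 recTN recT0; field.
Qed.
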